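(* Let $(G,u)$ be a unital po-group (not necessarily Abelian) satisfying (RDP). Then the state space $\mathcal S(G,u)$ is either empty or a nonempty Choquet simplex. The same is true for the state space $\mathcal S(\Gamma(G,u))$ of the pseudo effect algebra $\Gamma(G,u)$: it is either empty or a nonempty Choquet simplex.
   Context: Groups are written additively and are not assumed Abelian. A po-group is a group $G$ with a partial order $\le$ such that $a\le b$ implies $x+a+y\le x+b+y$ for all $x,y\in G$; $G^+=\{g\in G: g\ge 0\}$. A strong unit of $G$ is an element $u\in G^+$ such that for every $g\in G$ there is an integer $n\ge1$ with $g\le nu$; a unital po-group $(G,u)$ is a po-group with a fixed strong unit $u$ (it is then directed). (RDP) for a directed po-group $G$: for all $a_1,a_2,b_1,b_2\in G^+$ with $a_1+a_2=b_1+b_2$ there are $d_1,d_2,d_3,d_4\in G^+$ with $d_1+d_2=a_1$, $d_3+d_4=a_2$, $d_1+d_3=b_1$, $d_2+d_4=b_2$. $\Gamma(G,u)=\{g\in G:0\le g\le u\}$ with the partial addition that is the restriction of the group addition ($a+b$ is defined iff the group sum lies in $\Gamma(G,u)$) and constants $0,u$; this is a pseudo effect algebra with top element $1=u$. A state on $(G,u)$ is a group homomorphism $s:G\to\mathbb R$ with $s(G^+)\subseteq\mathbb R^+$ and $s(u)=1$; $\mathcal S(G,u)$ is the set of all states. A state on $E=\Gamma(G,u)$ is a map $s:E\to[0,1]$ with $s(a+b)=s(a)+s(b)$ whenever $a+b$ is defined in $E$ and $s(u)=1$; $\mathcal S(E)$ is the set of all states on $E$. Both are convex sets with the topology of pointwise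 (weak) convergence, viewed as subsets of the locally convex spaces $\mathbb R^G$, $\mathbb R^E$. A convex cone in a real vector space $V$ is a subset $C$ containing $0$ and closed under linear combinations with nonnegative coefficients; it is strict if $C\cap(-C)=\{0\}$, and then $x\le_C y$ iff $y-x\in C$ is a partial order. A lattice cone is a strict convex cone $C$ that is a lattice under $\le_C$. A base for a convex cone $C$ is a convex subset $K\subseteq C$ such that every nonzero $y\in C$ is uniquely of the form $y=\alpha x$ with $\alpha\ge0$ real, $x\in K$. A simplex is a convex subset of a real vector space that is affinely isomorphic (via a bijection preserving convex combinations in both directions) to a base for a lattice cone in some real vector space. A Choquet simplex is a compact simplex in a locally convex Hausdorff space. *)

(* Defs.v *)
From HB Require Import structures.
From mathcomp Require Import all_boot all_order all_algebra.
From mathcomp Require Import all_classical all_reals all_analysis.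

Set Implicit Arguments.
Unset Strict Implicit.
Unset Printing Implicit Defensive.

Import Order.TTheory GRing.Theory Num.Theory.
Import numFieldNormedType.Exports.

Local Open Scope classical_set_scope.
Local Open Scope ring_scope.

(* Groups are not assumed Abelian, so they are MathComp's [groupType]s, which
   are written multiplicatively: the additive x + y, 0, n x of the mathematics
   are x * y, 1, x ^+ n in [group_scope]. *)

HB.mixin Record isPOGroup (d : Order.disp_t) G
    of Group G & Order.POrder d G := {
  lepg_mul2 : forall x y a b : G,
    (a <= b)%O -> ((x * a * y)%g <= (x * b * y)%g)%O
}.

#[short(type="pogroupType")]
HB.structure Definition POGroup (d : Order.disp_t) :=
  {G of isPOGroup d G & Group G & Order.POrder d G}.

HB.mixin Record hasStrongUnit (d : Order.disp_t) G of POGroup d G := {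
  sunit : G;
  sunit_ge1 : ((1%g : G) <= sunit)%O;
  sunitP : forall g : G, exists2 n : nat, (1 <= n)%N & (g <= (sunit ^+ n)%g)%O
}.

#[short(type="unitalPOGroupType")]
HB.structure Definition UnitalPOGroup (d : Order.disp_t) :=
  {G of hasStrongUnit d G & POGroup d G}.

Definition posg (d : Order.disp_t) (G : pogroupType d) : set G :=
  [set g | ((1%g : G) <= g)%O].

Definition RDP (d : Order.disp_t) (G : pogroupType d) : Prop :=
  forall a1 a2 b1 b2 : G,
    posg a1 -> posg a2 -> posg b1 -> posg b2 ->
    (a1 * a2 = b1 * b2)%g ->
    exists d1 d2 d3 d4 : G,
      [/\ posg d1, posg d2, posg d3 & posg d4] /\
      [/\ (d1 * d2 = a1)%g, (d3 * d4 = a2)%g,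
          (d1 * d3 = b1)%g & (d2 * d4 = b2)%g].

Section Gamma.
Context (d : Order.disp_t) (G : unitalPOGroupType d).

Definition in_Gamma (g : G) : bool := ((1%g : G) <= g <= sunit)%O.

Definition Gamma : Type := {g : G | in_Gamma g}.

HB.instance Definition _ := [isSub of Gamma for @sval G in_Gamma].

Lemma in_Gamma0 : in_Gamma 1%g.
Proof. by rewrite /in_Gamma lexx sunit_ge1. Qed.

Lemma in_Gamma1 : in_Gamma sunit.
Proof. by rewrite /in_Gamma lexx sunit_ge1. Qed.

Definition Gamma0 : Gamma := Sub 1%g in_Gamma0.
Definition Gamma1 : Gamma := Sub sunit in_Gamma1.

(* [None] encodes that the partial sum is undefined. *)
Definition Gamma_add (a b : Gamma) : option Gamma :=
  insub (val a * val b)%g.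

End Gamma.
Arguments Gamma {d} G.
Arguments Gamma0 {d G}.
Arguments Gamma1 {d G}.

(* The space R^T with the product topology, i.e. pointwise convergence. *)
Definition ptws_space (R : realType) (T : Type) : Type := {ptws T -> R^o}.

Section PtwsSpace.
Context (R : realType) (T : Type).

HB.instance Definition _ := Uniform.copy (ptws_space R T) {ptws T -> R^o}.
HB.instance Definition _ := GRing.Lmodule.copy (ptws_space R T) (T -> R^o).

Lemma ptws_space_cvgP (F : set_system (ptws_space R T)) (f : ptws_space R T) :
  Filter F ->
  (F --> f) <-> (forall t, (fun g : ptws_space R T => g t) @ F --> (f t : R^o)).
Proof.
move=> FF; have surjE t : range (fun g : ptws_space R T => g t) = setT.
  by rewrite eqEsubset; split=> v // _; exists (cst v).
split=> [Ff t | Ff].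
  have /cvg_sup/(_ t) := Ff; rewrite cvg_image//.
  by apply: cvg_trans => W /=; rewrite ?nbhs_simpl /fmap /= => [[W' + <-]];
    apply: filterS => g W'g /=; exists g.
apply/cvg_sup => t; rewrite cvg_image// => W /=; rewrite ?nbhs_simpl => /Ff Q.
exists ((fun g : ptws_space R T => g t) @^-1` W) => //.
by rewrite eqEsubset; split => [j [? + <-//]|j Wj]; exists (fun _ => j).
Qed.

Lemma ptws_space_eval_continuous (t : T) :
  continuous (fun g : ptws_space R T => (g t : R^o)).
Proof. by move=> f; have /ptws_space_cvgP := @cvg_id _ (nbhs f); apply. Qed.

Lemma ptws_space_continuous (S : topologicalType) (h : S -> ptws_space R T) :
  (forall t, continuous (fun x => h x t : R^o)) -> continuous h.
Proof.
move=> hc x; have FF : Filter (h @ x) by exact: fmap_filter.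
by apply: (iffRL (ptws_space_cvgP _ FF)) => t; exact: hc.
Qed.

Let ptws_space_add_continuous :
  continuous (fun x : ptws_space R T * ptws_space R T => x.1 + x.2).
Proof.
apply: ptws_space_continuous => t [f g].
have c1 : (fun x : ptws_space R T * ptws_space R T => x.1 t : R^o)
    @ (f, g) --> (f t : R^o).
  by apply: (cvg_comp fst (fun h : ptws_space R T => h t));
    [exact: cvg_fst|exact: ptws_space_eval_continuous].
have c2 : (fun x : ptws_space R T * ptws_space R T => x.2 t : R^o)
    @ (f, g) --> (g t : R^o).
  by apply: (cvg_comp snd (fun h : ptws_space R T => h t));
    [exact: cvg_snd|exact: ptws_space_eval_continuous].
exact: (cvgD c1 c2).
Qed.

Let ptws_space_scale_continuous :
  continuous (fun z : R^o * ptws_space R T => z.1 *: z.2).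
Proof.
apply: ptws_space_continuous => t [r f].
have c1 : (fun z : R^o * ptws_space R T => z.1) @ (r, f) --> (r : R^o).
  exact: cvg_fst.
have c2 : (fun z : R^o * ptws_space R T => z.2 t : R^o)
    @ (r, f) --> (f t : R^o).
  by apply: (cvg_comp snd (fun h : ptws_space R T => h t));
    [exact: cvg_snd|exact: ptws_space_eval_continuous].
exact: (cvgM c1 c2).
Qed.

Let ptws_space_locally_convex : exists2 B : set_system (ptws_space R T),
  (forall b, b \in B -> convex_set b) & basis B.
Proof.
pose B : set_system (ptws_space R T) := [set U | open U /\ convex_set U].
exists B; first by move=> b /set_mem[].
split; first by move=> U [].
move=> f; have FF : Filter (filter_from [set U | B U /\ U f] id).
  apply: filter_from_filter.
    exists setT; split=> //; split; first exact: openT.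
    by move=> x y l _ _; rewrite in_setT.
  move=> U V [[oU cU] Uf] [[oV cV] Vf]; exists (U `&` V) => //.
  split; last by split.
  split; first exact: openI.
  move=> x y l; rewrite !in_setI => /andP[xU xV] /andP[yU yV].
  by rewrite cU ?cV.
apply: (iffRL (@ptws_space_cvgP _ f FF)) => t W Wft.
have [C cC [oC /(_ (f t) W Wft) [V /= [CV Vft] VW]]] := @locally_convex R R^o.
exists ((fun g : ptws_space R T => g t) @^-1` V); last by move=> g /= /VW.
split; last exact: Vft.
split.
  apply: open_comp; last exact: oC.
  by move=> x _; exact: ptws_space_eval_continuous.
move=> x y l /set_mem xV /set_mem yV; apply/mem_set.
by apply/set_mem/(cC V); exact/mem_set.
Qed.

HB.instance Definition _ := PreTopologicalNmodule_isTopologicalNmodule.Build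
  (ptws_space R T) ptws_space_add_continuous.
HB.instance Definition _ := TopologicalNmodule_isTopologicalLmodule.Build
  R (ptws_space R T) ptws_space_scale_continuous.
HB.instance Definition _ :=
  Uniform_isTvs.Build R (ptws_space R T) ptws_space_locally_convex.

End PtwsSpace.

Section Simplex.
Context (R : realType).

Definition cone_le (V : lmodType R) (C : set V) (x y : V) : Prop := C (y - x).

Definition convex_cone (V : lmodType R) (C : set V) : Prop :=
  C 0 /\ forall (a b : R) (x y : V),
    0 <= a -> 0 <= b -> C x -> C y -> C (a *: x + b *: y).

Definition strict_cone (V : lmodType R) (C : set V) : Prop :=
  convex_cone C /\ C `&` [set x | C (- x)] = [set 0].

Definition cone_is_sup (V : lmodType R) (C : set V) (x y z : V) : Prop :=
  [/\ C z, cone_le C x z, cone_le C y z &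
      forall w, C w -> cone_le C x w -> cone_le C y w -> cone_le C z w].

Definition cone_is_inf (V : lmodType R) (C : set V) (x y z : V) : Prop :=
  [/\ C z, cone_le C z x, cone_le C z y &
      forall w, C w -> cone_le C w x -> cone_le C w y -> cone_le C w z].

Definition lattice_cone (V : lmodType R) (C : set V) : Prop :=
  strict_cone C /\ forall x y, C x -> C y ->
    (exists z, cone_is_sup C x y z) /\ (exists z, cone_is_inf C x y z).

Definition cone_base (V : lmodType R) (C K : set V) : Prop :=
  [/\ convex_set K, K `<=` C &
      forall y, C y -> y <> 0 ->
        exists! ax : R * V, [/\ 0 <= ax.1, K ax.2 & y = ax.1 *: ax.2]].

Definition affine_on (V W : lmodType R) (K : set V) (f : V -> W) : Prop :=
  forall (x y : V) (t : R), K x -> K y -> 0 <= t <= 1 ->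
    f (t *: x + (1 - t) *: y) = t *: f x + (1 - t) *: f y.

Definition affinely_isomorphic (V W : lmodType R) (K : set V) (L : set W) :
    Prop :=
  exists (f : V -> W) (g : W -> V),
    [/\ set_fun K L f /\ set_fun L K g,
        {in K, cancel f g}, {in L, cancel g f},
        affine_on K f & affine_on L g].

Definition simplex (V : lmodType R) (K : set V) : Prop :=
  convex_set K /\
  exists (W : lmodType R) (C L : set W),
    [/\ lattice_cone C, cone_base C L & affinely_isomorphic K L].

(* A [tvsType] is locally convex, but not necessarily Hausdorff. *)
Definition choquet_simplex (V : tvsType R) (K : set V) : Prop :=
  [/\ hausdorff_space V, compact K & simplex K].

End Simplex.

Section States.
Context (R : realType) (d : Order.disp_t) (G : unitalPOGroupType d).

Definition group_states : set (ptws_space R G) :=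
  [set s | [/\ forall x y : G, s (x * y)%g = s x + s y,
               forall x : G, posg x -> 0 <= s x
             & s sunit = 1]].

Definition Gamma_states : set (ptws_space R (Gamma G)) :=
  [set s | [/\ forall a : Gamma G, 0 <= s a <= 1,
               forall a b c : Gamma G,
                 Gamma_add a b = Some c -> s c = s a + s b
             & s Gamma1 = 1]].

End States.

Arguments group_states R {d} G.
Arguments Gamma_states R {d} G.

(* Main.v *)
Require Import Defs.
From mathcomp Require Import all_boot all_order all_algebra.
From mathcomp Require Import all_classical all_reals all_analysis.
Local Open Scope classical_set_scope.

Set Implicit Arguments.
Unset Strict Implicit.
Unset Printing Implicit Defensive.

Import Order.TTheory GRing.Theory Num.Theory.
Import numFieldNormedType.Exports.

(** The states on [(G, u)] form a base of the cone of positive homomorphisms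
    [G -> R]: a nonzero positive homomorphism is positive at the strong unit,
    and dividing by its value there is the only way to normalize it. So the
    group part of the theorem amounts to this cone being a lattice, plus
    compactness.

    The sup of two positive homomorphisms [f] and [g] is given on the positive
    cone by the Riesz-Kantorovich formula
      [(f \/ g) x = sup {f a + g b : x = a b, a >= 1, b >= 1}].
    Subadditivity of this function is where (RDP) enters: a factorization of
    [x y] refines into factorizations of [x] and of [y]. Superadditivity holds
    although [G] need not be Abelian, because for [x = a b] and [y = a' b'] the
    product [x y = a b a' b'] can be rewritten as [a a' (b ^ a') b'], where the
    conjugate [b ^ a'] is still positive and [g], being a homomorphism to an
    Abelian group, does not see the conjugation.
    An additive function on the positive cone is in the same way invariant
    under conjugation, so it extends to [G] by [a b^-1 |-> h a - h b]
    ([extend_posg_hom]). Infima come from suprema by [x + y - sup].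

    For the interval [Gamma G], restriction of states is an affine bijection
    from the states of [G], which transports the simplex structure. By (RDP),
    every positive element is a product of elements of [Gamma G]
    ([posg_Gamma_prod]), whence injectivity. For surjectivity, a state of
    [Gamma G] is summed along such a product; (RDP) refines any two of these
    products of the same element into a common matrix, so that the sum does not
    depend on the choice ([Gamma_additive_sum]), and the result extends to [G].

    Both state spaces are cut out of a product of compact intervals by closed
    pointwise conditions, hence are compact by Tychonoff's theorem. *)

(** * Positive elements and Riesz refinement *)

Section PositiveCone.
Local Open Scope group_scope.
Context {d : Order.disp_t} {G : pogroupType d}.
Implicit Types x y a b : G.

Lemma posg1 : posg (1 : G).
Proof. exact: lexx. Qed.

Lemma posgV_mul a b : posg (a^-1 * b) <-> (a <= b)%O.
Proof.
split=> [|ab]; first by move=> /(lepg_mul2 a 1%g); rewrite !mulg1 mulVKg.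
by have := lepg_mul2 a^-1 1 _ _ ab; rewrite !mulg1 mulVg.
Qed.

Lemma le_mul_posg a b : posg b -> (a <= a * b)%O.
Proof. by move=> b0; apply/posgV_mul; rewrite mulKg. Qed.

Lemma posgM a b : posg a -> posg b -> posg (a * b).
Proof. by move=> a0 /(le_mul_posg a); apply: le_trans. Qed.

Lemma posgJ a x : posg a -> posg (a ^ x).
Proof. by move=> /(lepg_mul2 x^-1 x); rewrite mulg1 mulVg -mulgA. Qed.

Lemma le_posg_mul a b : posg b -> (a <= b * a)%O.
Proof. by move=> b0; rewrite conjgC; apply/le_mul_posg/posgJ. Qed.

Lemma posgM_eq1 {a b} : posg a -> posg b -> a * b = 1 -> a = 1.
Proof.
move=> a0 b0 ab1; apply: le_anti.
by rewrite -{1}ab1 (le_mul_posg a b0).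
Qed.

Lemma posg_prod (xs : seq G) :
  (forall x, x \in xs -> posg x) -> posg (\prod_(x <- xs) x).
Proof. by move=> xs0; rewrite big_seq; apply: (big_ind _ posg1 posgM xs0). Qed.

Definition generated_by_posg :=
  forall x, exists a b, [/\ posg a, posg b & x = a / b].

(** Refinement of one product of arbitrary length against one of length two.
    Writing the two factors of each entry side by side, as a list of pairs,
    records the 2-row refinement matrix in which the entries of [xs] are the
    column products. *)
Lemma RDP_split (xs : seq G) b1 b2 : RDP G ->
  (forall x, x \in xs -> posg x) -> posg b1 -> posg b2 ->
  \prod_(x <- xs) x = b1 * b2 ->
  exists ps : seq (G * G),
    [/\ forall p, p \in ps -> posg p.1 /\ posg p.2,
        [seq p.1 * p.2 | p <- ps] = xs,
        \prod_(p <- ps) p.1 = b1 & \prod_(p <- ps) p.2 = b2].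
Proof.
move=> rdp; elim: xs b1 b2 => [|x xs IH] b1 b2 xs0 b10 b20.
  rewrite big_nil => /esym b12; have b11 := posgM_eq1 b10 b20 b12.
  by exists [::]; split=> //; rewrite big_nil ?b11 // -b12 b11 mul1g.
have x0 : posg x by apply: xs0; rewrite mem_head.
have {}xs0 y : y \in xs -> posg y.
  by move=> yxs; apply: xs0; rewrite inE yxs orbT.
have p0 := posg_prod xs0.
rewrite big_cons => /(rdp _ _ _ _ x0 p0 b10 b20).
move=> [d1 [d2 [d3 [d4 [[d10 d20 d30 d40] [e1 e2 e3 e4]]]]]].
have [ps [ps0 psxs ps1 ps2]] := IH _ _ xs0 d30 d40 (esym e2).
exists ((d1, d2) :: ps); split; rewrite ?big_cons ?ps1 ?ps2 //=.
  by move=> p; rewrite inE => /predU1P[->|/ps0].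
by rewrite psxs e1.
Qed.

End PositiveCone.
Arguments generated_by_posg {d} G.

(** * From the positive cone to the group *)

Section Extension.
Local Open Scope ring_scope.
Context {d : Order.disp_t} {G : pogroupType d} {V : zmodType}.
Implicit Types (f h : G -> V) (x y a b : G).

(** The extension is forced to be [a / b |-> h a - h b]. It does not depend on
    the fraction and is a homomorphism because [h] is invariant under
    conjugation: [h b + h (a ^ b) = h (a b) = h a + h b] since [V] is Abelian.
    This makes up for the failure of positive elements to commute. *)
Lemma extend_posg_hom h : generated_by_posg G ->
  (forall a b, posg a -> posg b -> h (a * b)%g = h a + h b) ->
  exists f, (forall x y, f (x * y)%g = f x + f y) /\
    forall a, posg a -> f a = h a.
Proof.
move=> genG hD.
have hJ a b : posg a -> posg b -> h (a ^ b)%g = h a.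
  move=> a0 b0; apply: (@addrI _ (h b)).
  by rewrite -hD //; [rewrite -conjgC hD // addrC | exact: posgJ].
have hdiv a b a' b' : posg a -> posg b -> posg a' -> posg b' ->
    (a / b = a' / b')%g -> h a - h b = h a' - h b'.
  (* Clearing denominators gives [a (b' ^ b) = a' b]. *)
  move=> a0 b0 a'0 b'0 e; apply/eqP; rewrite subr_eq addrAC -addrA.
  rewrite eq_sym addrA subr_eq -(hJ b' b) // -!hD //; last exact: posgJ.
  apply/eqP; congr h.
  by rewrite conjgE mulgA mulgA e mulgVK.
have /choice[ab abP] : forall x, exists ab : G * G,
    [/\ posg ab.1, posg ab.2 & x = (ab.1 / ab.2)%g].
  by move=> x; have [a [b]] := genG x; exists (a, b).
exists (fun x => h (ab x).1 - h (ab x).2); split=> [x y|a a0]; last first.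
  have [p0 q0 e] := abP a.
  rewrite (hdiv _ _ a 1%g) ?divg1 //; last exact: posg1.
  have := hD _ _ posg1 posg1; rewrite mulg1 => /eqP.
  by rewrite -subr_eq subrr => /eqP <-; rewrite subr0.
have [p0 q0 e] := abP (x * y)%g.
have [a0 b0 ex] := abP x; have [a'0 b'0 ey] := abP y.
set a := (ab x).1 in a0 ex *; set b := (ab x).2 in b0 ex *.
set a' := (ab y).1 in a'0 ey *; set b' := (ab y).2 in b'0 ey *.
have c0 := posgJ b a'0.
(* [(a / b) (a' / b') = (a (a' ^ b)) / (b' b)] *)
rewrite (hdiv _ _ (a * a' ^ b)%g (b' * b)%g) //; try exact/posgM.
  by rewrite (hD a) // hJ // (hD b') // [h b' + _]addrC opprD addrACA.
by rewrite -e ex ey conjgE invgM !mulgA mulgK.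
Qed.

End Extension.

(** * The lattice cone of positive homomorphisms *)

Section PtwsSpaceOps.
Local Open Scope ring_scope.
Context {R : realType} {T : Type}.
Implicit Types (f g : ptws_space R T) (t : T) (a : R).

Lemma ptws_spaceDE f g t : (f + g) t = f t + g t. Proof. by []. Qed.
Lemma ptws_spaceBE f g t : (f - g) t = f t - g t. Proof. by []. Qed.
Lemma ptws_spaceZE a f t : (a *: f) t = a * f t. Proof. by []. Qed.

Lemma ptws_space_convE (l : {i01 R}) (f g : convex_lmodType (ptws_space R T))
    t :
  conv l f g t = l%:num * f t + (1 - l%:num) * g t.
Proof. by []. Qed.

Definition ptws_spaceE := (ptws_spaceBE, ptws_spaceDE, ptws_spaceZE).

End PtwsSpaceOps.

Section LatticeCone.
Local Open Scope ring_scope.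

(** A sup of [x] and [y] yields their inf as in any lattice-ordered group: the
    reflection [v |-> x + y - v] reverses the order and exchanges [x] and [y].
    The reflected sup stays in the cone because [x + y] is itself an upper
    bound and so dominates the sup. *)
Lemma cone_is_inf_of_sup (R : realType) (V : lmodType R) (C : set V)
    (x y z : V) :
  convex_cone C -> C x -> C y ->
  cone_is_sup C x y z -> cone_is_inf C x y (x + y - z).
Proof.
move=> [_ CZD] Cx Cy [Cz xz yz lub].
have CD v w : C v -> C w -> C (v + w).
  by move=> Cv Cw; have := CZD 1 1 v w ler01 ler01 Cv Cw; rewrite !scale1r.
split.
- apply: lub; first exact: CD.
    by rewrite /cone_le addrAC subrr add0r.
  by rewrite /cone_le addrK.
- by rewrite /cone_le opprB addrCA opprD addNKr.
- by rewrite /cone_le opprB addrCA opprD [- x - y]addrC addNKr.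
- move=> w Cw wx wy; rewrite /cone_le addrAC; apply: lub.
  + by rewrite -addrAC; exact: CD.
  + by rewrite /cone_le addrAC [x + y]addrC addrK.
  + by rewrite /cone_le addrAC addrK.
Qed.

End LatticeCone.

Section PositiveHoms.
Local Open Scope ring_scope.
Context {R : realType} {d : Order.disp_t} {G : unitalPOGroupType d}.
Implicit Types (f g : ptws_space R G) (x y a b : G).

(** The strong unit makes [G] directed: [x] is bounded by some [u ^+ n], and
    [x = u ^+ n / (x^-1 u ^+ n)]. *)
Lemma unital_generated_by_posg : generated_by_posg G.
Proof.
move=> x; have [n _ xn] := sunitP x.
exists (sunit ^+ n)%g, (x^-1 * sunit ^+ n)%g; split.
- elim: n {xn} => [|n IH]; first exact: posg1.
  by rewrite expgS; apply: posgM => //; exact: sunit_ge1.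
- exact/posgV_mul.
by rewrite invgM invgK mulVKg.
Qed.

Definition pos_homs : set (ptws_space R G) :=
  [set f | (forall x y, f (x * y)%g = f x + f y) /\
           forall x, posg x -> 0 <= f x].

Lemma pos_hom1 f : pos_homs f -> f 1%g = 0.
Proof. by case=> fD _; apply: (@addIr _ (f 1%g)); rewrite -fD mulg1 add0r. Qed.

Lemma pos_homV f x : pos_homs f -> f x^-1%g = - f x.
Proof.
move=> fP; have [fD _] := fP; apply/eqP.
by rewrite -addr_eq0 -fD mulVg pos_hom1.
Qed.

Lemma pos_homX f x n : pos_homs f -> f (x ^+ n)%g = f x *+ n.
Proof.
move=> fP; have [fD _] := fP.
by elim: n => [|n IH]; [rewrite pos_hom1|rewrite expgS fD IH mulrS].
Qed.

Lemma pos_hom_le f x y : pos_homs f -> (x <= y)%O -> f x <= f y.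
Proof.
move=> fP /posgV_mul xy; have [fD f0] := fP.
by have := f0 _ xy; rewrite fD pos_homV // addrC subr_ge0.
Qed.

Lemma pos_hom_ext f g : pos_homs f -> pos_homs g ->
  (forall x, posg x -> f x = g x) -> f = g.
Proof.
move=> fP gP fg; apply/funext => x.
have [a [b [a0 b0 ->]]] := unital_generated_by_posg x.
have [fD _] := fP; have [gD _] := gP.
by rewrite fD gD !pos_homV // !fg.
Qed.

(** The value at the strong unit controls every value; this is what makes the
    states a base of the cone. *)
Lemma pos_hom_eq0 f : pos_homs f -> f sunit = 0 -> f = 0.
Proof.
move=> fP fu; apply/funext => x.
suff le0 y : f y <= 0.
  by apply/le_anti; rewrite le0 -oppr_le0 -pos_homV // le0.
have [n _ yn] := sunitP y.
by apply: le_trans (pos_hom_le fP yn) _; rewrite pos_homX // fu mul0rn.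
Qed.

Lemma pos_homs_convex_cone : convex_cone pos_homs.
Proof.
split; first by split=> [x y|//]; rewrite addr0.
move=> a b f g a0 b0 [fD f0] [gD g0]; split=> [x y|x x0].
  by rewrite !ptws_spaceE fD gD !mulrDr addrACA.
by apply: addr_ge0; apply: mulr_ge0; [|exact: f0| |exact: g0].
Qed.

Lemma pos_homs_strict_cone : strict_cone pos_homs.
Proof.
split; first exact: pos_homs_convex_cone.
apply/seteqP; split=> [f [fP fNP]|_ ->]; last first.
  by split=> /=; rewrite ?oppr0; have [] := pos_homs_convex_cone.
apply: pos_hom_eq0 => //; apply/le_anti/andP; split.
  by rewrite -oppr_ge0; exact: (fNP.2 _ sunit_ge1).
exact: (fP.2 _ sunit_ge1).
Qed.

Section Sup.
Context (rdp : RDP G) (f g : ptws_space R G).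
Context (fP : pos_homs f) (gP : pos_homs g).

Let splits x := [set r : R | exists a b,
  [/\ posg a, posg b, x = (a * b)%g & r = f a + g b]].

Let h x := sup (splits x).

Let splits_ub x : has_ubound (splits x).
Proof.
exists (f x + g x) => _ [a [b [a0 b0 -> ->]]].
apply: lerD; apply: pos_hom_le => //; [exact: le_mul_posg|exact: le_posg_mul].
Qed.

Let le_h a b : posg a -> posg b -> f a + g b <= h (a * b)%g.
Proof. by move=> a0 b0; apply: ub_le_sup; [|exists a, b]. Qed.

Let h_le x r : posg x ->
  (forall a b, posg a -> posg b -> x = (a * b)%g -> f a + g b <= r) -> h x <= r.
Proof.
move=> x0 le_r; apply: ge_sup => [|_ [a [b [a0 b0 xab ->]]]]; last exact: le_r.
by exists (f x + g 1%g), x, 1%g; split=> //; [exact: posg1|rewrite mulg1].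
Qed.

(** Additivity of the Riesz-Kantorovich formula: (RDP) gives [<=], and moving
    [b] past [a'] by conjugation gives [>=]. *)
Let hD x y : posg x -> posg y -> h (x * y)%g = h x + h y.
Proof.
move=> x0 y0; apply/le_anti/andP; split.
  apply: h_le; first exact: posgM.
  move=> a b a0 b0 /(rdp x0 y0 a0 b0).
  move=> [d1 [d2 [d3 [d4 [[d10 d20 d30 d40] [<- <- <- <-]]]]]].
  by rewrite fP.1 gP.1 addrACA lerD // le_h.
rewrite -lerBrDr; apply: h_le => // a b a0 b0 xab.
rewrite lerBrDr addrC -lerBrDr; apply: h_le => // a' b' a'0 b'0 yab.
rewrite lerBrDr addrC.
have -> : (x * y = (a * a') * (b ^ a' * b'))%g.
  by rewrite xab yab conjgE !mulgA mulgK.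
apply: le_trans (le_h (posgM a0 a'0) (posgM (posgJ a' b0) b'0)).
rewrite fP.1 gP.1 conjgE !gP.1 pos_homV // [g b + _]addrC addKr.
by rewrite addrACA.
Qed.

Lemma pos_homs_sup : exists s, cone_is_sup pos_homs f g s.
Proof.
have [s [sD sh]] := extend_posg_hom unital_generated_by_posg hD.
have fs x : posg x -> f x <= s x.
  move=> x0; rewrite sh //; have := le_h x0 posg1.
  by rewrite mulg1 (pos_hom1 gP) addr0.
have gs x : posg x -> g x <= s x.
  move=> x0; rewrite sh //; have := le_h posg1 x0.
  by rewrite mul1g (pos_hom1 fP) add0r.
have subP k t : (forall x y, k (x * y)%g = k x + k y) ->
    (forall x y, t (x * y)%g = t x + t y) ->
    (forall x, posg x -> k x <= t x) -> pos_homs (t - k : ptws_space R G).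
  move=> kD tD kt; split=> [x y|x x0]; last by rewrite subr_ge0 kt.
  by rewrite !ptws_spaceE kD tD opprD addrACA.
exists s; split.
- by split=> // x x0; apply: le_trans (fs x x0); exact: fP.2.
- exact: subP fP.1 sD fs.
- exact: subP gP.1 sD gs.
move=> w wP [_ fw] [_ gw]; apply: subP sD wP.1 _ => x x0; rewrite sh //.
apply: h_le => // a b a0 b0 ->; rewrite wP.1.
apply: lerD; rewrite -subr_ge0; [exact: fw|exact: gw].
Qed.

End Sup.

Lemma pos_homs_lattice_cone : RDP G -> lattice_cone pos_homs.
Proof.
move=> rdp; split; first exact: pos_homs_strict_cone.
move=> f g fP gP; have [s sP] := pos_homs_sup rdp fP gP.
split; first by exists s.
exists (f + g - s); apply: cone_is_inf_of_sup => //.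
exact: pos_homs_convex_cone.
Qed.

Lemma group_statesE : group_states R G = [set f | pos_homs f /\ f sunit = 1].
Proof. by apply/seteqP; split=> [f [? ? ?]|f [[? ?] ?]]. Qed.

Lemma group_states_convex : convex_set (group_states R G).
Proof.
move=> f g l; rewrite group_statesE !inE => -[fP fu] [gP gu]; split.
  have [_] := pos_homs_convex_cone; apply=> //.
  by rewrite subr_ge0.
by rewrite ptws_space_convE fu gu !mulr1 addrC subrK.
Qed.

Lemma group_states_cone_base : cone_base pos_homs (group_states R G).
Proof.
split; first exact: group_states_convex.
  by rewrite group_statesE => f [].
rewrite group_statesE => f fP f_neq0.
have fu0 : 0 <= f sunit := fP.2 _ sunit_ge1.
have fu : f sunit != 0 by apply/eqP => /(pos_hom_eq0 fP).
exists (f sunit, (f sunit)^-1 *: f); split=> [|[a s] /= [a0 [sP su] fE]].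
  split=> //=; last by rewrite scalerA mulfV // scale1r.
  split; last by rewrite ptws_spaceZE mulVf.
  have [C0 CZD] := pos_homs_convex_cone.
  have := CZD (f sunit)^-1 0 f 0; rewrite scale0r addr0; apply=> //.
  by rewrite invr_ge0.
have fua : f sunit = a by rewrite fE ptws_spaceZE su mulr1.
by rewrite fua {1}fE scalerA mulVf ?scale1r // -fua.
Qed.

End PositiveHoms.
Arguments pos_homs R {d} G.

(** * States of the unit interval *)

Section GammaExtension.
Local Open Scope ring_scope.
Context {R : realType} {d : Order.disp_t} {G : unitalPOGroupType d}.
Implicit Types (x y a b : G) (xs ys : seq G).

Lemma in_Gamma_factors a b : posg a -> posg b ->
  in_Gamma (a * b)%g -> in_Gamma a /\ in_Gamma b.
Proof.
move=> a0 b0 /andP[_ ab1]; split; apply/andP; split=> //.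
  exact: le_trans (le_mul_posg a b0) ab1.
exact: le_trans (le_posg_mul b a0) ab1.
Qed.

(** An element below [u ^+ n] divides [u ^+ n] in the positive cone; refining
    this factorization against the [n] factors [u] writes it as a product of
    [n] divisors of [u], that is, of elements of the interval. *)
Lemma posg_Gamma_prod x : RDP G -> posg x ->
  exists2 xs, all (@in_Gamma d G) xs & (\prod_(y <- xs) y)%g = x.
Proof.
move=> rdp x0; have [n _ xn] := sunitP x.
have nseqE : (\prod_(y <- nseq n sunit) y)%g = (x * (x^-1 * sunit ^+ n))%g :> G.
  rewrite mulVKg; elim: n {xn} => [|n IH]; first by rewrite big_nil.
  by rewrite big_cons IH expgS.
have nseq0 y : y \in nseq n (sunit : G) -> posg y.
  by move=> /nseqP[-> _]; exact: sunit_ge1.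
have [ps [ps0 psE ps1 _]] :=
  RDP_split rdp nseq0 x0 (iffRL (posgV_mul _ _) xn) nseqE.
exists [seq p.1 | p <- ps]; last by rewrite big_map.
apply/allP => _ /mapP[p pps ->]; have [p10 p20] := ps0 p pps.
suff /(in_Gamma_factors p10 p20)[] : in_Gamma (p.1 * p.2)%g by [].
have : (p.1 * p.2)%g \in nseq n (sunit : G).
  by rewrite -psE; apply/mapP; exists p.
by move=> /nseqP[-> _]; exact: in_Gamma1.
Qed.

Section GammaAdditive.
Context (s : G -> R).
Context (sD : forall a b, in_Gamma a -> in_Gamma b -> in_Gamma (a * b)%g ->
  s (a * b)%g = s a + s b).

Lemma Gamma_additive1 : s 1%g = 0.
Proof.
have g1 := in_Gamma0 G.
by apply: (@addIr _ (s 1%g)); rewrite add0r -sD ?mulg1.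
Qed.

Lemma Gamma_additive_prod xs : (forall x, x \in xs -> posg x) ->
  in_Gamma (\prod_(x <- xs) x)%g ->
  s (\prod_(x <- xs) x)%g = \sum_(x <- xs) s x.
Proof.
elim: xs => [|x xs IH] xs0; first by rewrite !big_nil Gamma_additive1.
have x0 : posg x by apply: xs0; rewrite mem_head.
have {}xs0 y : y \in xs -> posg y.
  by move=> yxs; apply: xs0; rewrite inE yxs orbT.
have p0 := posg_prod xs0.
rewrite !big_cons => xp; have [x1 p1] := in_Gamma_factors x0 p0 xp.
by rewrite sD // IH.
Qed.

(** Induction on [ys]: splitting [xs] against [y] and the product of the
    remaining entries gives a row whose product is [y], which has the right sum
    as all its partial products stay in the interval, and a row to which the
    induction applies. Only the sums, not the factors, need to commute. *)
Lemma Gamma_additive_sum xs ys : RDP G ->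
  (forall x, x \in xs -> in_Gamma x) -> (forall y, y \in ys -> in_Gamma y) ->
  (\prod_(x <- xs) x)%g = (\prod_(y <- ys) y)%g ->
  \sum_(x <- xs) s x = \sum_(y <- ys) s y.
Proof.
move=> rdp; have pos x : in_Gamma x -> posg x by case/andP.
elim: ys xs => [|y ys IH] xs xsG ysG xys.
  rewrite -Gamma_additive_prod ?xys ?big_nil ?Gamma_additive1 //.
    by move=> x /xsG /pos.
  exact: in_Gamma0.
have yG : in_Gamma y by apply: ysG; rewrite mem_head.
have {}ysG z : z \in ys -> in_Gamma z.
  by move=> zys; apply: ysG; rewrite inE zys orbT.
have p0 := posg_prod (fun z zys => pos _ (ysG z zys)).
move: xys; rewrite big_cons => xys.
have [ps [ps0 psE ps1 ps2]] :=
  RDP_split rdp (fun x xxs => pos _ (xsG x xxs)) (pos _ yG) p0 xys.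
have psG p : p \in ps -> in_Gamma (p.1 * p.2)%g.
  by move=> pps; apply: xsG; rewrite -psE; apply/mapP; exists p.
have ps12 p : p \in ps -> in_Gamma p.1 /\ in_Gamma p.2.
  by move=> pps; have [p10 p20] := ps0 p pps; exact/in_Gamma_factors/psG.
rewrite big_cons -psE big_map big_seq.
under eq_bigr => p pps.
  have [p1 p2] := ps12 p pps; rewrite (sD p1 p2 (psG p pps)); over.
rewrite -big_seq big_split /=; congr (_ + _).
  rewrite -[LHS](big_map fst predT s) -Gamma_additive_prod ?big_map ?ps1 //.
  by move=> _ /mapP[p /ps0[p0' _] ->].
rewrite -[LHS](big_map snd predT s); apply: IH => //; last by rewrite big_map.
by move=> _ /mapP[p /ps12[_ p2] ->].
Qed.

End GammaAdditive.

Definition restrict_Gamma (s : ptws_space R G) : ptws_space R (Gamma G) :=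
  fun e : Gamma G => s (val e).

Lemma restrict_Gamma_state s :
  group_states R G s -> Gamma_states R G (restrict_Gamma s).
Proof.
rewrite group_statesE => -[sP su]; split=> [a|a b c|//].
  have /andP[a0 a1] := valP a.
  by rewrite sP.2 //= -su; exact: pos_hom_le.
rewrite /Gamma_add /restrict_Gamma; case: insubP => //= e _ eE [<-].
by rewrite eE sP.1.
Qed.

Lemma restrict_Gamma_inj s t : RDP G -> group_states R G s ->
  group_states R G t -> restrict_Gamma s = restrict_Gamma t -> s = t.
Proof.
rewrite group_statesE => rdp [sP _] [tP _] st.
apply: pos_hom_ext => // x /(posg_Gamma_prod rdp)[xs xsG <-].
have prodE f : pos_homs R G f ->
    f (\prod_(y <- xs) y)%g = \sum_(y <- xs) f y.
  by move=> fP; apply: (big_morph f fP.1 (pos_hom1 fP)).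
rewrite !prodE //; apply: eq_big_seq => y /(allP xsG) yG.
by have := congr1 (fun f => f (Sub y yG)) st.
Qed.

(** The extension of [t] to a positive element is the sum of [t] along any of
    its factorizations in the interval; the default value 0 outside the
    interval in [t'] is never met by such a factorization. *)
Lemma Gamma_state_extends t : RDP G -> Gamma_states R G t ->
  exists2 s, group_states R G s & restrict_Gamma s = t.
Proof.
move=> rdp [t01 tD tu]; pose t' x := oapp t 0 (insub x : option (Gamma G)).
have t'E (a : Gamma G) : t' (val a) = t a by rewrite /t' valK.
have t'D a b : in_Gamma a -> in_Gamma b -> in_Gamma (a * b)%g ->
    t' (a * b)%g = t' a + t' b.
  move=> aG bG abG; rewrite (t'E (Sub a aG)) (t'E (Sub b bG)) (t'E (Sub _ abG)).
  by apply: tD; rewrite /Gamma_add /= insubT.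
have t'0 x : 0 <= t' x.
  by rewrite /t'; case: insub => //= a; have /andP[] := t01 a.
have /choice[dec decP] x : exists xs, posg x ->
    (forall y, y \in xs -> in_Gamma y) /\ (\prod_(y <- xs) y)%g = x.
  have [x0|] := pselect (posg x); last by exists [::].
  by have [xs /allP] := posg_Gamma_prod rdp x0; exists xs.
pose h x := \sum_(y <- dec x) t' y.
have hE x xs : posg x -> (forall y, y \in xs -> in_Gamma y) ->
    (\prod_(y <- xs) y)%g = x -> h x = \sum_(y <- xs) t' y.
  move=> x0 xsG xsx; have [decG decx] := decP x x0.
  by apply: Gamma_additive_sum => //; rewrite decx.
have hD x y : posg x -> posg y -> h (x * y)%g = h x + h y.
  move=> x0 y0; have [xG xE] := decP x x0; have [yG yE] := decP y y0.
  rewrite (hE _ (dec x ++ dec y)) ?big_cat ?xE ?yE //; first exact: posgM.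
  by move=> z; rewrite mem_cat => /orP[/xG|/yG].
have [s [sD sh]] := extend_posg_hom unital_generated_by_posg hD.
have sE (a : Gamma G) : s (val a) = t a.
  have aG := valP a; have a0 : posg (val a) by case/andP: aG.
  rewrite sh // (hE _ [:: val a]) ?big_seq1 // => y.
  by rewrite inE => /eqP ->.
exists s; last exact/funext/sE.
split=> //; last by rewrite -tu -sE.
by move=> x x0; rewrite sh //; apply: sumr_ge0.
Qed.

End GammaExtension.

(** * Compactness *)

Section Topology.
Local Open Scope ring_scope.
Context {R : realType} {T : Type}.
Implicit Types (t : T).

Lemma ptws_space_hausdorff : hausdorff_space (ptws_space R T).
Proof.
(* The product topology does not depend on the decidable equality on [T] that
   {classic T} provides. *)
have := @hausdorff_product {classic T} (fun=> R^o)
  (fun=> @norm_hausdorff _ R^o).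
exact.
Qed.

Lemma ptws_space_box_compact (l u : T -> R) :
  compact [set f : ptws_space R T | forall t, l t <= f t <= u t].
Proof.
have := @tychonoff {classic T} (fun=> R^o) (fun t => [set` `[l t, u t]]).
move=> /(_ (fun=> @segment_compact _ _ _)).
by congr compact; apply/seteqP; split=> f /= fP t; have := fP t; rewrite in_itv.
Qed.

Lemma closed_ptws_all (I : Type) (P : I -> set (ptws_space R T)) :
  (forall i, closed (P i)) -> closed [set f | forall i, P i f].
Proof.
move=> cP; have -> : [set f | forall i, P i f] = \bigcap_(i in setT) P i.
  by apply/seteqP; split=> [f fP i _|f fP i]; exact: fP.
exact: closed_bigI.
Qed.

Lemma closed_ptws_eval (D : set R^o) t :
  closed D -> closed [set f : ptws_space R T | D (f t)].
Proof.
by apply: preimage_closed => f _; exact: ptws_space_eval_continuous.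
Qed.

Lemma closed_ptws_add t1 t2 t3 :
  closed [set f : ptws_space R T | f t1 = f t2 + f t3].
Proof.
have -> : [set f : ptws_space R T | f t1 = f t2 + f t3] =
    (fun f : ptws_space R T => f t1 - (f t2 + f t3) : R^o) @^-1`
    [set x | x = 0].
  apply/seteqP; split=> f /= => [->|/eqP]; first by rewrite subrr.
  by rewrite subr_eq0 => /eqP.
apply: preimage_closed; last exact: closed_eq.
move=> f _; have c t := @ptws_space_eval_continuous R T t f.
exact: (cvgB (c t1) (cvgD (c t2) (c t3))).
Qed.

End Topology.

(** * The two state spaces *)

Section StateSpaces.
Local Open Scope ring_scope.
Context {R : realType} {d : Order.disp_t} {G : unitalPOGroupType d}.

Lemma group_states_compact : compact (group_states R G).
Proof.
have /choice[n nP] : forall x : G, exists n, (x <= (sunit ^+ n)%g)%O.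
  by move=> x; have [n _ xn] := sunitP x; exists n.
(* [x <= u ^+ n x] gives [s x <= n x]; the same bound for [x^-1] bounds [s x]
   from below. *)
apply: (subclosed_compact _ (@ptws_space_box_compact R G
  (fun x => - (n x^-1%g)%:R) (fun x => (n x)%:R))).
  (* Quantifying over a sigma type turns each implication into a family of
     plain pointwise conditions. *)
  have -> : group_states R G =
      [set s | forall x y : G, s (x * y)%g = s x + s y] `&`
      ([set s | forall x : {x : G | posg x}, 0 <= s (sval x)] `&`
       [set s | s sunit = 1]).
    apply/seteqP; split=> [s [sD s0 su]|s [/= sD [s0 su]]].
      by split=> //; split=> // -[x x0] /=; exact: s0.
    by split=> // x x0; exact: (s0 (exist _ x x0)).
  apply: closedI; last apply: closedI.
  - apply: closed_ptws_all => x; apply: closed_ptws_all => y.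
    exact: closed_ptws_add.
  - apply: closed_ptws_all => x.
    by apply: (@closed_ptws_eval _ _ [set r | 0 <= r]); exact: closed_ge.
  - by apply: (@closed_ptws_eval _ _ [set r | r = 1]); exact: closed_eq.
rewrite group_statesE => s [sP su] x.
have le_n y : s y <= (n y)%:R.
  by have := pos_hom_le sP (nP y); rewrite pos_homX // su.
by rewrite le_n andbT lerNl -pos_homV.
Qed.

Lemma Gamma_states_compact : compact (Gamma_states R G).
Proof.
apply: (subclosed_compact _ (@ptws_space_box_compact R (Gamma G)
  (fun=> 0) (fun=> 1))); last by move=> s [].
have -> : Gamma_states R G =
    [set s | forall a, 0 <= s a <= 1] `&`
    ([set s | forall abc : {abc : Gamma G * Gamma G * Gamma G |
         Gamma_add abc.1.1 abc.1.2 = Some abc.2},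
       s (sval abc).2 = s (sval abc).1.1 + s (sval abc).1.2] `&`
     [set s | s Gamma1 = 1]).
  apply/seteqP; split=> [s [s01 sD su]|s [/= s01 [sD su]]].
    by split=> //; split=> // -[[[a b] c] /= abc]; exact: sD.
  by split=> // a b c abc; exact: (sD (exist _ (a, b, c) abc)).
apply: closedI; last apply: closedI.
- apply: closed_ptws_all => a.
  apply: (@closed_ptws_eval _ _ [set r | 0 <= r <= 1]).
  have -> : [set r : R^o | 0 <= r <= 1] = [set r | 0 <= r] `&` [set r | r <= 1].
    by apply/seteqP; split=> r /=; [move=> /andP|move=> /andP].
  by apply: closedI; [exact: closed_ge|exact: closed_le].
- by apply: closed_ptws_all => abc; exact: closed_ptws_add.
- by apply: (@closed_ptws_eval _ _ [set r | r = 1]); exact: closed_eq.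
Qed.

Lemma group_states_simplex : RDP G -> simplex (group_states R G).
Proof.
move=> rdp; split; first exact: group_states_convex.
exists (ptws_space R G), (pos_homs R G), (group_states R G); split.
- exact: pos_homs_lattice_cone.
- exact: group_states_cone_base.
by exists id, id; split=> //; split.
Qed.

Lemma Gamma_states_convex : convex_set (Gamma_states R G).
Proof.
move=> f g l; rewrite !inE => -[f01 fD fu] [g01 gD gu].
have l0 : 0 <= l%:num by [].
have l1 : 0 <= 1 - l%:num by rewrite subr_ge0.
split=> [a|a b c abc|]; rewrite ?ptws_space_convE.
- have /andP[fa0 fa1] := f01 a; have /andP[ga0 ga1] := g01 a.
  rewrite addr_ge0 ?mulr_ge0 //=.
  rewrite -[leRHS](subrK l%:num) addrC.
  by apply: lerD; rewrite ler_piMr.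
- by rewrite (fD _ _ _ abc) (gD _ _ _ abc) !mulrDr addrACA.
- by rewrite fu gu !mulr1 addrC subrK.
Qed.

(** The cone and its base are those of [G], reached through extension and
    restriction of states. Restriction is linear, so extension is affine because
    a state is determined by its restriction. *)
Lemma Gamma_states_simplex : RDP G -> simplex (Gamma_states R G).
Proof.
move=> rdp; split; first exact: Gamma_states_convex.
exists (ptws_space R G), (pos_homs R G), (group_states R G); split.
- exact: pos_homs_lattice_cone.
- exact: group_states_cone_base.
have /choice[ext extP] (t : ptws_space R (Gamma G)) : exists s,
    Gamma_states R G t -> group_states R G s /\ restrict_Gamma s = t.
  have [tS|] := pselect (Gamma_states R G t); last by exists 0.
  by have [s] := Gamma_state_extends rdp tS; exists s.
have convG (V : lmodType R) (K : set V) x y (t : R) :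
    convex_set K -> K x -> K y -> 0 <= t <= 1 -> K (t *: x + (1 - t) *: y).
  move=> Kc Kx Ky /andP[t0 t1].
  have := Kc x y (Itv01 t0 t1); rewrite !inE; exact.
exists ext, (@restrict_Gamma _ _ _); split.
- by split=> [t /extP[]|s /restrict_Gamma_state].
- by move=> t /set_mem /extP[].
- move=> s /set_mem sS; have [eS eE] := extP _ (restrict_Gamma_state sS).
  exact: restrict_Gamma_inj eE.
- move=> x y t xS yS t01.
  have [exS exE] := extP _ xS; have [eyS eyE] := extP _ yS.
  have [eS eE] := extP _ (convG _ _ _ _ _ Gamma_states_convex xS yS t01).
  apply: restrict_Gamma_inj => //.
    exact: convG group_states_convex _ _ _.
  by rewrite eE -[in LHS]exE -[in LHS]eyE.
- by [].
Qed.

End StateSpaces.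

Theorem theorem4p2 (R : realType) (d : Order.disp_t)
    (G : unitalPOGroupType d) (hRDP : RDP G) :
  (group_states R G = set0 \/
   (group_states R G !=set0 /\ choquet_simplex (group_states R G))) /\
  (Gamma_states R G = set0 \/
   (Gamma_states R G !=set0 /\ choquet_simplex (Gamma_states R G))).
Proof.
split.
  have [->|/set0P G0] := eqVneq (group_states R G) set0; first by left.
  right; split=> //; split; [exact: ptws_space_hausdorff| |].
    exact: group_states_compact.
  exact: group_states_simplex.
have [->|/set0P G0] := eqVneq (Gamma_states R G) set0; first by left.
right; split=> //; split; [exact: ptws_space_hausdorff| |].
  exact: Gamma_states_compact.
exact: Gamma_states_simplex.
Qed.
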